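(* Let $m,d,r$ be positive integers with $1\leq r\leq\binom{m+d}{d}$. Let $\omega_r(d,m)=(\beta_1,\dots,\beta_{m+1})$ and let $l$ be the smallest index for which $\beta_l\neq 0$. Then $$\binom{m+d}{d}-\binom{m+d+1-l}{d}<r\leq\binom{m+d}{d}-\binom{m+d-l}{d},$$ and $$f_r(d,m;q)=H_r(d,m;q)+\pi_{m-l-1}(q).$$
   Context: For integers $d,m\ge 0$ let $\Omega(d,m)=\{(\gamma_1,\dots,\gamma_{m+1})\in\mathbb{Z}_{\ge 0}^{m+1}:\sum_{i=1}^{m+1}\gamma_i=d\}$, ordered lexicographically. For $1\leq r\leq |\Omega(d,m)|=\binom{m+d}{d}$, let $\omega_r(d,m)=(\beta_1,\dots,\beta_{m+1})$ be its $r$-th largest element, and put $H_r(d,m;q):=\sum_{i=1}^m\beta_i q^{m-i}$. Let $\pi_m(q)=\frac{q^{m+1}-1}{q-1}=1+q+\dots+q^m$ for $m\ge 0$ and $\pi_m(q)=0$ for $m<0$. For fixed $m,d,r$ all these are polynomials in $q$. For positive integers $m,d,r$ with $1\leq r\leq\binom{m+d}{d}$, let $l_0$ be the unique integer $1\leq l_0\leq m+1$ with $\binom{m+d}{d}-\binom{m+d+1-l_0}{d}<r\leq\binom{m+d}{d}-\binom{m+d-l_0}{d}$, let $j=r-\binom{m+d}{d}+\binom{m+d+1-l_0}{d}$, and define $$f_r(d,m;q):=H_j(d-1,m-l_0+1;q)+\pi_{m-l_0}(q).$$ *)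

(* Defs.v *)
From mathcomp Require Import all_boot all_order all_algebra.
Set Implicit Arguments.
Unset Strict Implicit.
Unset Printing Implicit Defensive.
Import Order.TTheory GRing.Theory Num.Theory.
Local Open Scope ring_scope.

(* Since the entries sum to d they are at most d, so 'I_d.+1 is no restriction;
   tuplelexi selects the lexicographic order on tuples. *)
Definition Omega (d m : nat) : {set m.+1.-tuplelexi 'I_d.+1} :=
  [set t : m.+1.-tuplelexi 'I_d.+1 | (\sum_(i <- t) (i : nat))%N == d].

(* r is counted from 1; the default value is only reached for r > #|Omega d m|
   (and r = 0 is read as r = 1). *)
Definition omega (r d m : nat) : m.+1.-tuplelexi 'I_d.+1 :=
  nth [tuple ord0 | _ < m.+1] (sort >=%O (enum (Omega d m))) r.-1.

(* The entry beta_i of omega_r(d,m), with i counted from 1 to m+1. *)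
Definition beta (r d m i : nat) : nat := nth ord0 (omega r d m) i.-1.

Definition Hpoly (r d m : nat) : {poly int} :=
  \sum_(1 <= i < m.+1) (beta r d m i)%:R * 'X^(m - i).

Definition pipoly (k : int) : {poly int} :=
  match k with
  | Posz n => \sum_(i < n.+1) 'X^i
  | Negz _ => 0
  end.

Definition in_range (m d r l : nat) : bool :=
  ('C(m + d, d) - 'C(m + d + 1 - l, d) < r
     <= 'C(m + d, d) - 'C(m + d - l, d))%N.

Definition l0 (m d r : nat) : nat :=
  head 0%N [seq l <- iota 1 m.+1 | in_range m d r l].

Fact card_Omega (d m : nat) : #|Omega d m| = 'C(m + d, d).
Proof.
rewrite -bin_sub ?leq_addl // addnK -card_ord_partitions.
by apply: eq_card => t; rewrite !inE.
Qed.

Fact l0_exists (m d r : nat) : (0 < d)%N -> (1 <= r <= 'C(m + d, d))%N ->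
  (1 <= l0 m d r <= m.+1)%N /\ in_range m d r (l0 m d r).
Proof.
move=> d0 /andP[r1 rC].
have : has (in_range m d r) (iota 1 m.+1).
  pose P l := (r <= 'C(m + d, d) - 'C(m + d - l, d))%N.
  have exP : exists l, P l.
    exists m.+1; rewrite /P [X in (_ - X)%N]bin_small ?subn0 //.
    by case: (d) d0 => // d' _; rewrite addnS subSS addKn.
  case: (ex_minnP exP) => l Pl lmin.
  have l1 : (0 < l)%N.
    by case: l Pl {lmin} => //; rewrite /P subn0 subnn leqNgt r1.
  apply/hasP; exists l.
    rewrite mem_iota l1 add1n ltnS; apply: lmin.
    rewrite /P [X in (_ - X)%N]bin_small ?subn0 //.
    by case: (d) d0 => // d' _; rewrite addnS subSS addKn.
  apply/andP; split; last exact: Pl.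
  rewrite ltnNge; apply/negP => rl.
  have : P l.-1 by rewrite /P; case: l l1 rl {Pl lmin} => // l _; rewrite addn1 subSS.
  by move=> /lmin; rewrite leqNgt prednK ?leqnn.
rewrite has_filter /l0; case E: filter => [//|l s] _ /=.
have : l \in l :: s by rewrite mem_head.
by rewrite -E mem_filter mem_iota add1n ltnS => /andP[].
Qed.

Fact l0_unique (m d r l : nat) : (0 < d)%N -> (1 <= r <= 'C(m + d, d))%N ->
  (1 <= l <= m.+1)%N -> in_range m d r l -> l = l0 m d r.
Proof.
move=> d0 hr hl Hl; have [hl' Hl'] := l0_exists d0 hr.
move: Hl' hl'; set l' := l0 m d r => Hl' hl'.
have aux a b : in_range m d r a -> in_range m d r b -> (a <= b)%N.
  move=> /andP[ha _] /andP[_ hb]; rewrite leqNgt; apply/negP => ba.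
  have /(leq_trans ha) := hb; rewrite ltnNge => /negP; apply.
  apply: leq_sub2l; apply: leq_bin2l.
  by case: a ba {ha} => // a; rewrite ltnS addn1 subSS => ?; apply: leq_sub2l.
by apply/eqP; rewrite eqn_leq !aux.
Qed.

(* The index r - (A - B) is r - A + B, without truncation in r - A; likewise
   m + 1 - l0 is m - l0 + 1, which is 0 when l0 = m + 1. *)
Definition fpoly (r d m : nat) : {poly int} :=
  let l := l0 m d r in
  let j := (r - ('C(m + d, d) - 'C(m + d + 1 - l, d)))%N in
  Hpoly j (d - 1) (m + 1 - l) + pipoly (m%:Z - l%:Z).

(* Main.v *)
(* Adding 1 to the first entry identifies Omega(d-1,m) with the part of
   Omega(d,m) where beta_1 > 0, prepending 0 identifies Omega(d,m-1) with the
   part where beta_1 = 0, and the first part precedes the second in decreasing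
   lexicographic order. Hence omega_r(d,m) is obtained from omega_r(d-1,m) or
   from omega_{r'}(d,m-1) with r' = r - binom(m+d-1,d-1); the theorem follows by
   induction on m, the case l = 1 being the first part. *)
Require Import Defs.
From mathcomp Require Import all_boot all_order all_algebra.
From mathcomp Require Import zify.
Import Order.TTheory GRing.Theory Num.Theory.
Local Open Scope ring_scope.

(* The elements of Omega d m, in decreasing lexicographic order. *)
Fixpoint omega_list (m d : nat) : seq (seq nat) :=
  if m is m'.+1 then
    (fix ol d := (if d is d'.+1 then [seq incr_nth s 0 | s <- ol d'] else [::])
                 ++ [seq 0%N :: s | s <- omega_list m' d]) d
  else [:: [:: d]].

Lemma omega_listS (m d : nat) :
  omega_list m.+1 d.+1 = [seq incr_nth s 0 | s <- omega_list m.+1 d]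
                         ++ [seq 0%N :: s | s <- omega_list m d.+1].
Proof. by []. Qed.

Lemma size_omega_list (m d : nat) : size (omega_list m d) = 'C(m + d, d).
Proof.
elim: m d => [|m IHm] d; first by rewrite add0n binn.
elim: d => [|d IHd]; first by rewrite /= size_map IHm !bin0.
by rewrite omega_listS size_cat !size_map IHd IHm addSnnS !addnS binS addnC.
Qed.

Lemma mem_omega_list (m d : nat) (s : seq nat) :
  (s \in omega_list m d) = (size s == m.+1) && (sumn s == d).
Proof.
elim: m d s => [|m IHm] d s.
  rewrite inE; case: s => [|x [|y s]] //; last by rewrite eqseq_cons andbF.
  by rewrite eqseq_cons andbT /= addn0.
elim: d s => [|d IHd] s.
  apply/mapP/idP => [[t + ->]|]; first by rewrite IHm.
  case: s => [|[|x] s] //= h; last by rewrite andbF in h.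
  by exists s; rewrite ?IHm.
rewrite omega_listS mem_cat; apply/orP/idP => [[]/mapP[t + ->]|].
- by rewrite IHd; case: t.
- by rewrite IHm.
case: s => [|[|x] s] //= h; [right | left]; apply/mapP.
  by exists s; rewrite ?IHm.
by exists (x :: s); rewrite ?IHd.
Qed.

(** Across the two blocks a positive head beats the head 0. The strict order yields both sortedness
    and absence of duplicates for [map_sort_Omega]. *)
Lemma pairwise_omega_list (m d : nat) :
  pairwise (>%O : rel (seqlexi nat)) (omega_list m d).
Proof.
elim: m d => [//|m IHm] d.
have cons0 k :
    pairwise (>%O : rel (seqlexi nat)) [seq 0%N :: s | s <- omega_list m k].
  rewrite pairwise_map; apply: sub_pairwise (IHm k) => s t.
  by rewrite /= ltxi_cons.
elim: d => [|d IHd]; first exact: cons0.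
rewrite omega_listS pairwise_cat cons0 andbT; apply/andP; split.
  apply/allrelP => _ _ /mapP[s hs ->] /mapP[t _ ->].
  by move: hs; rewrite mem_omega_list; case: s => [|x s] //= _; rewrite ltxi_cons.
rewrite pairwise_map.
(* Incrementing the head is strictly monotone only on nonempty sequences: [[::]] and [[:: 0]] both
   become [[:: 1]]. *)
apply: (@sub_in_pairwise _ [pred s | s != [::]]) IHd.
  by move=> [|x s] [|y t] //= _ _; rewrite !ltxi_cons !leEnat !ltnS.
by apply/allP => -[|x s] //; rewrite mem_omega_list.
Qed.

Lemma lexi_map_ord (n : nat) (s t : seqlexi 'I_n) :
  ([seq val i | i <- s] <= [seq val i | i <- t] :> seqlexi nat)%O = (s <= t)%O.
Proof. by elim: s t => [|x s IHs] [|y t] //=; rewrite !lexi_cons IHs. Qed.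

(** Both sides are decreasing, duplicate-free and have the same members, so antisymmetry of the
    order forces equality. *)
Lemma map_sort_Omega (m d : nat) :
  [seq [seq val i | i <- tval t] | t <- sort >=%O (enum (Omega d m))]
  = omega_list m d.
Proof.
pose f (t : m.+1.-tuplelexi 'I_d.+1) : seqlexi nat := [seq val i | i <- tval t].
apply: (@sorted_eq _ (>=%O : rel (seqlexi nat)));
  [exact: ge_trans | exact: ge_anti | | |].
- apply: (@homo_sorted _ _ f (>=%O)); last exact: sort_sorted ge_total _.
  by move=> s t; rewrite /f /= lexi_map_ord.
- rewrite sorted_pairwise; last exact: ge_trans.
  by apply: sub_pairwise (pairwise_omega_list m d) => s t /ltW.
apply: uniq_perm.
- rewrite map_inj_uniq ?sort_uniq ?enum_uniq // => s t /(inj_map val_inj) st.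
  exact: val_inj.
- apply: (pairwise_uniq _ (pairwise_omega_list m d)) => s; exact: ltxx.
move=> s; rewrite mem_omega_list.
apply/mapP/idP => [[t]|/andP[/eqP sz_s /eqP sum_s]]; rewrite ?mem_sort.
  rewrite mem_enum inE => /eqP sum_t ->.
  by rewrite size_map size_tuple eqxx sumnE big_map sum_t eqxx.
(* An entry is at most the sum, so [inord] below loses nothing. *)
have le_d x : x \in s -> (x < d.+1)%N.
  by move=> xs; rewrite ltnS -sum_s sumnE (big_rem x xs) leq_addr.
pose u : seq 'I_d.+1 := [seq inord x | x <- s].
have uE : [seq val i | i <- u] = s.
  rewrite -map_comp -[RHS]map_id; apply/eq_in_map => x /le_d.
  exact: inordK.
have sz_u : size u == m.+1 by rewrite size_map sz_s.
exists (Tuple sz_u); last by rewrite /f uE.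
by rewrite mem_sort mem_enum inE -[d in _ == d]sum_s -uE sumnE big_map.
Qed.

Lemma beta_omega_list (m d r i : nat) :
  (0 < r <= 'C(m + d, d))%N -> (0 < i <= m.+1)%N ->
  beta r d m i = nth 0%N (nth [::] (omega_list m d) r.-1) i.-1.
Proof.
move=> /andP[r0 rC] /andP[i0 im].
rewrite -map_sort_Omega (nth_map [tuple ord0 | _ < m.+1]); last first.
  by rewrite size_sort -cardE card_Omega prednK.
by rewrite (nth_map ord0) // size_tuple prednK.
Qed.

Lemma bin_add_succ (m d : nat) :
  'C(m.+1 + d.+1, d.+1) = ('C(m.+1 + d, d) + 'C(m + d.+1, d.+1))%N.
Proof. by rewrite addnS binS addnC -addSnnS. Qed.

(** Such an [r] points into the first block of [omega_listS]. *)
Lemma beta_incr (m d r i : nat) :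
  (0 < r <= 'C(m.+1 + d, d))%N -> (0 < i <= m.+2)%N ->
  beta r d.+1 m.+1 i = ((i == 1) + beta r d m.+1 i)%N.
Proof.
move=> r_le i_le; have /andP[r0 rC] := r_le.
have rS : (0 < r <= 'C(m.+1 + d.+1, d.+1))%N.
  by rewrite r0 bin_add_succ (leq_trans rC) ?leq_addr.
rewrite !beta_omega_list // omega_listS nth_cat size_map size_omega_list.
rewrite prednK // rC (nth_map [::]) ?size_omega_list ?prednK // nth_incr_nth.
by case: i i_le => [|[|i]].
Qed.

(** The offset is the length of the first block, so the index points into the second. *)
Lemma beta_shift (m d r i : nat) :
  (0 < r <= 'C(m + d.+1, d.+1))%N -> (0 < i <= m.+2)%N ->
  beta ('C(m.+1 + d, d) + r) d.+1 m.+1 i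
  = if i == 1 then 0%N else beta r d.+1 m i.-1.
Proof.
move=> r_le i_le; have /andP[r0 rC] := r_le.
have rS : (0 < 'C(m.+1 + d, d) + r <= 'C(m.+1 + d.+1, d.+1))%N.
  by rewrite addn_gt0 r0 orbT bin_add_succ leq_add2l.
rewrite beta_omega_list // omega_listS nth_cat size_map size_omega_list.
have -> : ('C(m.+1 + d, d) + r).-1 = ('C(m.+1 + d, d) + r.-1)%N by lia.
rewrite ltnNge leq_addr /= addKn (nth_map [::]) ?size_omega_list ?prednK //.
by case: i i_le => [|[|i]] //= i_le; rewrite beta_omega_list.
Qed.

(** Only the coefficient at [i = 1] grows, and its monomial is ['X^(m.+1 - 1)]. *)
Lemma Hpoly_incr (m d r : nat) :
  (0 < r <= 'C(m.+1 + d, d))%N ->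
  Hpoly r d.+1 m.+1 = Hpoly r d m.+1 + 'X^m.
Proof.
move=> hr; rewrite /Hpoly [in LHS]big_nat_recl // [in RHS]big_nat_recl //.
rewrite beta_incr // natrD mulrDl mul1r subSS subn0.
rewrite -addrA addrC; congr (_ + _ + _).
by apply: eq_big_nat => -[|i] // hi; rewrite beta_incr //; lia.
Qed.

Lemma Hpoly_shift (m d r : nat) :
  (0 < r <= 'C(m + d.+1, d.+1))%N ->
  Hpoly ('C(m.+1 + d, d) + r) d.+1 m.+1 = Hpoly r d.+1 m.
Proof.
move=> hr; rewrite /Hpoly big_nat_recl // beta_shift // mul0r add0r.
apply: eq_big_nat => i /andP[i0 im].
by rewrite beta_shift // ?subSS; case: i i0 im => // i _ /ltnW.
Qed.

Lemma pipoly_recr (n : nat) : pipoly n = 'X^n + pipoly (n%:Z - 1).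
Proof.
rewrite /pipoly big_ord_recr addrC; congr (_ + _).
case: n => [|n]; first by rewrite big_ord0.
by have -> : n.+1%:Z - 1 = n%:Z by lia.
Qed.

(** The formula is stated with [l] in place of [l0], so that the induction never has to compute
    [l0]. *)
Lemma Hpoly_shape (m d r l : nat) :
  (0 < r <= 'C(m + d.+1, d.+1))%N -> (0 < l <= m.+1)%N ->
  beta r d.+1 m l != 0%N ->
  (forall i, 0 < i < l -> beta r d.+1 m i = 0)%N ->
  in_range m d.+1 r l /\
  Hpoly (r - ('C(m + d.+1, d.+1) - 'C(m + d.+1 + 1 - l, d.+1))) d (m + 1 - l)
    + pipoly (m%:Z - l%:Z)
  = Hpoly r d.+1 m + pipoly (m%:Z - l%:Z - 1).
Proof.
elim: m r l => [|m IHm] r l hr hl hbl hmin.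
  (* For [m = 0] both [Hpoly] sums are empty, and [pipoly] is taken at -1 and -2, where it is 0. *)
  have -> : l = 1%N by lia.
  move: hr; rewrite /in_range !add0n !addnK !subn1 /= binn bin_small //.
  by rewrite /Hpoly !big_geq //; split=> //; lia.
have /andP[r0 _] := hr; have binE := bin_add_succ m d.
case: (leqP r 'C(m.+1 + d, d)) => hrC.
  have l1 : l = 1%N.
    apply/eqP; rewrite eqn_leq (andP hl).1 andbT leqNgt; apply/negP => l1.
    have := hmin 1%N; rewrite l1 => /(_ isT).
    by rewrite beta_incr //; lia.
  (* With [l = 1] the index j is [r] itself, and the ['X^m] gained by [Hpoly_incr] is the top term
     of [pipoly m]. *)
  subst l; rewrite /in_range !addnK subnn subn0 Hpoly_incr ?r0 //.
  have -> : (m.+1 + d.+1 - 1 = m + d.+1)%N by lia.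
  have -> : m.+1%:Z - 1%:Z = m%:Z by lia.
  by rewrite pipoly_recr addrA binE addnK.
have l1 : (1 < l)%N.
  case: l hl hbl {hmin} => [|[|l]] // _.
  by rewrite -(subnKC (ltnW hrC)) beta_shift //; lia.
case: l l1 hl hbl hmin => // l l1 hl hbl hmin.
pose r' := (r - 'C(m.+1 + d, d))%N.
have rE : r = ('C(m.+1 + d, d) + r')%N by rewrite subnKC // ltnW.
have hr' : (0 < r' <= 'C(m + d.+1, d.+1))%N by lia.
have shiftE i : (0 < i <= m.+1)%N -> beta r d.+1 m.+1 i.+1 = beta r' d.+1 m i.
  by move=> hi; rewrite rE beta_shift //; case: i hi.
have hl' : (0 < l <= m.+1)%N by lia.
have hbl' : beta r' d.+1 m l != 0%N by rewrite -shiftE.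
have hmin' i : (0 < i < l)%N -> beta r' d.+1 m i = 0%N.
  by move=> hi; rewrite -shiftE ?hmin //; lia.
have [] := IHm r' l hr' hl' hbl' hmin'; rewrite /in_range => rng.
(* Since [m] and [l] drop together, their differences persist. The total binomial and [r] both drop
   by ['C(m.+1 + d, d)], so j is unchanged too. *)
have eqn1 : (m.+1 + d.+1 + 1 - l.+1 = m + d.+1 + 1 - l)%N by lia.
have eqn2 : (m.+1 + d.+1 - l.+1 = m + d.+1 - l)%N by lia.
have eqn3 : (m.+1 + 1 - l.+1 = m + 1 - l)%N by lia.
have eqz : m.+1%:Z - l.+1%:Z = m%:Z - l%:Z by lia.
(* These bounds ensure that the natural-number differences of binomials are not truncated. *)
have le1 : ('C(m + d.+1 + 1 - l, d.+1) <= 'C(m + d.+1, d.+1))%N.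
  by apply: leq_bin2l; lia.
have le2 : ('C(m + d.+1 - l, d.+1) <= 'C(m + d.+1, d.+1))%N.
  by apply: leq_bin2l; lia.
rewrite eqn1 eqn2 eqn3 eqz binE => shapeE; split; first by lia.
rewrite rE Hpoly_shift // -shapeE; congr (Hpoly _ _ _ + _); lia.
Qed.

Theorem proposition1p2 (m d r : nat) (hm : (0 < m)%N) (hd : (0 < d)%N)
    (hr : (1 <= r <= 'C(m + d, d))%N)
    (l : nat) (hl : (1 <= l <= m.+1)%N)
    (hbl : beta r d m l <> 0%N)
    (hmin : forall i : nat, (1 <= i < l)%N -> beta r d m i = 0%N) :
  ('C(m + d, d) - 'C(m + d + 1 - l, d) < r
     <= 'C(m + d, d) - 'C(m + d - l, d))%N
  /\ fpoly r d m = Hpoly r d m + pipoly (m%:Z - l%:Z - 1).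
Proof.
case: d hd hr hbl hmin => // d hd hr /eqP hbl hmin.
have [rng shapeE] := Hpoly_shape _ _ _ _ hr hl hbl hmin.
split; first exact: rng.
(* The range just proved identifies [l] with [l0]. *)
by rewrite /fpoly -(l0_unique hd hr hl rng) subn1.
Qed.
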